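(* Let $\Omega\subseteq\mathbb{R}^n$ be an open set. For a net $(u_\varepsilon)$ of functions in $\mathcal{C}^\infty(\Omega,\mathbb{R})$, indexed by $\varepsilon\in(0,1]$ in (i), (ii) and by $\varepsilon\in\hat I=\mathcal{D}(\mathbb{R}^d)$ in (iii), (iv): (i) $(u_\varepsilon)\in\mathcal{E}^{\mathrm{s}}_M(\Omega)$ if and only if $\forall K\Subset\Omega\ \forall\alpha\in\mathbb{N}^n\ \exists N\in\mathbb{N}:\ \sup_{x\in K}|\partial^\alpha u_\varepsilon(x)|=O(\varepsilon^{-N})$ as $\varepsilon\in\mathbb{I}^{\mathrm{s}}$; (ii) $(u_\varepsilon)\in\mathcal{N}^{\mathrm{s}}(\Omega)$ if and only if $\forall K\Subset\Omega\ \forall\alpha\in\mathbb{N}^n\ \forall m\in\mathbb{N}:\ \sup_{x\in K}|\partial^\alpha u_\varepsilon(x)|=O(\varepsilon^{m})$ as $\varepsilon\in\mathbb{I}^{\mathrm{s}}$; (iii) $(u_\varepsilon)\in\mathcal{M}(\mathcal{E}(\Omega)^{\mathcal{D}_0})$ if and only if $\forall K\Subset\Omega\ \forall\alpha\in\mathbb{N}^n\ \exists N\in\mathbb{N}:\ \sup_{x\in K}|\partial^\alpha u_\varepsilon(x)|=O(\underline{\varepsilon}^{-N})$ as $\varepsilon\in\hat{\mathbb{I}}$; (iv) $(u_\varepsilon)\in\mathcal{N}(\mathcal{E}(\Omega)^{\mathcal{D}_0})$ if and only if $\forall K\Subset\Omega\ \forall\alpha\in\mathbb{N}^n\ \forall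 m\in\mathbb{N}:\ \sup_{x\in K}|\partial^\alpha u_\varepsilon(x)|=O(\underline{\varepsilon}^{m})$ as $\varepsilon\in\hat{\mathbb{I}}$.
   Context: $\mathbb{N}=\{0,1,2,\dots\}$; $K\Subset\Omega$ means that $K$ is a compact subset of $\Omega$. Big-O. For a triple $\mathbb{I}=(I,\le,\mathcal{I})$ ($\le$ a pre-order on $I$, $\mathcal{I}$ a set of nonempty subsets of $I$), put $(\emptyset,e]:=\{\varepsilon\in I\mid\varepsilon\le e\}$ and $A_{\le e}:=(\emptyset,e]\cap A$. For real nets $(x_\varepsilon),(y_\varepsilon)\in\mathbb{R}^I$, ''$x_\varepsilon=O(y_\varepsilon)$ as $\varepsilon\in\mathbb{I}$'' means: there is $A\in\mathcal{I}$ such that for all $a\in A$ there are $H>0$ and $\varepsilon_0\in A_{\le a}$ with $|x_\varepsilon|\le H|y_\varepsilon|$ for all $\varepsilon\in A_{\le\varepsilon_0}$. The triple $\mathbb{I}^{\mathrm{s}}=(I^{\mathrm{s}},\le,\mathcal{I}^{\mathrm{s}})$: $I^{\mathrm{s}}=(0,1]$ with the usual order, $\mathcal{I}^{\mathrm{s}}=\{(0,\varepsilon_0]\mid\varepsilon_0\in(0,1]\}$. The triple $\hat{\mathbb{I}}=(\hat I,\le,\hat{\mathcal{I}})$: $\hat I=\mathcal{D}_0=\mathcal{D}(\mathbb{R}^d)$ ($d\ge1$) is the space of smooth compactly supported functions on $\mathbb{R}^d$; $\underline{\varphi}:=\mathrm{diam}(\mathrm{supp}(\varphi))$ if $\varphi\ne0$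 and $\underline{0}:=1$; $\varphi\le\psi$ iff $\underline\varphi\le\underline\psi$; and $\hat{\mathcal{I}}$ is a fixed free ultrafilter on $\mathcal{D}_0$ for which there are sets $\mathcal{D}_n\in\hat{\mathcal{I}}$ ($n\ge1$) with $\underline\varphi\le\frac1n$ for all $\varphi\in\mathcal{D}_n$. A property $\mathcal{P}(\varphi)$ holds almost everywhere (a.e.) if $\{\varphi\in\mathcal{D}_0\mid\mathcal{P}(\varphi)\}\in\hat{\mathcal{I}}$. Moderate and negligible nets. For nets indexed by $(0,1]$: $(u_\varepsilon)\in\mathcal{E}_M^{\mathrm{s}}(\Omega)$ iff $\forall K\Subset\Omega\,\forall\alpha\in\mathbb{N}^n\,\exists N\in\mathbb{N}$: $\sup_{x\in K}|\partial^\alpha u_\varepsilon(x)|=O(\varepsilon^{-N})$ as $\varepsilon\to0^+$ (usual Landau symbol); $(u_\varepsilon)\in\mathcal{N}^{\mathrm{s}}(\Omega)$ iff $\forall K\Subset\Omega\,\forall\alpha\in\mathbb{N}^n\,\forall m\in\mathbb{N}$: $\sup_{x\in K}|\partial^\alpha u_\varepsilon(x)|=O(\varepsilon^{m})$ as $\varepsilon\to0^+$. For nets indexed by $\mathcal{D}_0$: $(u_\varphi)\in\mathcal{M}(\mathcal{E}(\Omega)^{\mathcal{D}_0})$ iff $\forall K\Subset\Omega\,\forall\alpha\in\mathbb{N}^n\,\exists N\in\mathbb{N}\,\exists H>0$: $\sup_{x\in K}|\partial^\alpha u_\varphi(x)|\le H\underline{\varphi}^{-N}$ a.e.; $(u_\varphi)\in\mathcal{N}(\mathcal{E}(\Omega)^{\mathcal{D}_0})$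 iff $\forall K\Subset\Omega\,\forall\alpha\in\mathbb{N}^n\,\forall m\in\mathbb{N}\,\exists H>0$: $\sup_{x\in K}|\partial^\alpha u_\varphi(x)|\le H\underline{\varphi}^{m}$ a.e. *)

(* Defs.v *)
From HB Require Import structures.
From mathcomp Require Import all_boot all_order all_algebra.
From mathcomp Require Import all_classical all_reals all_analysis.

Set Implicit Arguments.
Unset Strict Implicit.
Unset Printing Implicit Defensive.

Import Order.TTheory GRing.Theory Num.Theory.
Import numFieldNormedType.Exports.

Local Open Scope classical_set_scope.
Local Open Scope ring_scope.

Section smooth_functions.
Context {R : realType} {n : nat}.
Implicit Types (f : 'rV[R]_n -> R) (W K : set 'rV[R]_n).

Definition pderiv (i : 'I_n) f : 'rV[R]_n -> R :=
  fun x => 'D_(delta_mx 0 i) f x.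

Definition pderivs (s : seq 'I_n) f := foldr pderiv f s.

(* 'D_v is total, so the existence of every derivative taken is required
   explicitly; on an open W all these conditions only depend on f in W. *)
Definition smooth_on W f := forall (s : seq 'I_n) x, W x ->
  {for x, continuous (pderivs s f)} /\
  forall i : 'I_n, derivable (pderivs s f) x (delta_mx 0 i).

Definition mderiv (alpha : 'I_n -> nat) f :=
  pderivs (flatten [seq nseq (alpha i) i | i <- enum 'I_n]) f.

(* The values of a function outside W are irrelevant. *)
Record smooth_fun W := SmoothFun {
  sfun :> 'rV[R]_n -> R;
  sfun_smooth : smooth_on W sfun }.

(* A supremum in R; it is 0 for K = set0. *)
Definition sup_mderiv K alpha f : R := sup [set `|mderiv alpha f x| | x in K].

Definition supp f : set 'rV[R]_n := closure [set x | f x != 0].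

(* The library norm of 'rV[R]_n is the maximum norm; diameters are taken for
   the Euclidean distance. *)
Definition edist (x y : 'rV[R]_n) : R :=
  Num.sqrt (\sum_(i < n) (x 0 i - y 0 i) ^+ 2).

Definition diam K : R := sup [set edist p.1 p.2 | p in K `*` K].

End smooth_functions.

Record indices := Indices {
  idx :> Type;
  idx_le : idx -> idx -> Prop;
  idx_fam : set (set idx);
  idx_le_refl : forall e, idx_le e e;
  idx_le_trans : forall e f g, idx_le e f -> idx_le f g -> idx_le e g;
  idx_fam_nonempty : forall A, idx_fam A -> A !=set0 }.

Definition upto (I : indices) (A : set I) (e : I) : set I :=
  [set f | idx_le f e] `&` A.

Definition bigO_idx (R : realType) (I : indices) (x y : I -> R) : Prop :=
  exists2 A : set I, idx_fam A & forall a, A a ->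
    exists H : R, 0 < H /\ exists2 e0 : I, upto A a e0 &
      forall e, upto A e0 e -> `|x e| <= H * `|y e|.

Section special_indices.
Context (R : realType).

Definition unit_oc : Type := {e : R | `]0, 1]%classic e}.

Definition special_le (e f : unit_oc) : Prop := sval e <= sval f.

Definition special_fam : set (set unit_oc) :=
  [set [set e | special_le e e0] | e0 in [set: unit_oc]].

Fact special_le_refl e : special_le e e.
Proof. exact: lexx. Qed.

Fact special_le_trans e f g :
  special_le e f -> special_le f g -> special_le e g.
Proof. exact: le_trans. Qed.

Fact special_fam_nonempty A : special_fam A -> A !=set0.
Proof. by case=> e0 _ <-; exists e0; exact: special_le_refl. Qed.

Definition special_idx : indices :=
  Indices special_le_refl special_le_trans special_fam_nonempty.

(* The filter e --> 0^+ on the type ]0, 1]. *)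
Definition to0 : set_system unit_oc := subset_filter 0^'+ `]0, 1]%classic.

#[global] Instance to0_filter : Filter to0.
Proof. exact: subset_filter_filter. Qed.

Canonical to0_filter_on := FilterType to0 to0_filter.

Context {n : nat} (Omega : set 'rV[R]_n).

Definition moderate_special (u : unit_oc -> smooth_fun Omega) : Prop :=
  forall K, compact K -> K `<=` Omega -> forall alpha : 'I_n -> nat,
  exists N : nat,
    (fun e => sup_mderiv K alpha (u e)) =O_to0 (fun e => sval e ^- N : R).

Definition negligible_special (u : unit_oc -> smooth_fun Omega) : Prop :=
  forall K, compact K -> K `<=` Omega -> forall (alpha : 'I_n -> nat) (m : nat),
    (fun e => sup_mderiv K alpha (u e)) =O_to0 (fun e => sval e ^+ m : R).

End special_indices.

Section test_function_indices.
Context (R : realType) (d : nat).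

Record test_fun := TestFun {
  tfun :> 'rV[R]_d -> R;
  tfun_smooth : smooth_on setT tfun;
  tfun_supp : compact (supp tfun) }.

Definition size_supp (phi : test_fun) : R :=
  if `[< tfun phi = cst 0 >] then 1 else diam (supp phi).

Definition free_filter (U : set_system test_fun) : Prop :=
  \bigcap_(A in U) A = set0.

Definition shrinking (U : set_system test_fun) : Prop :=
  exists D : nat -> set test_fun, forall n, (1 <= n)%N ->
    U (D n) /\ forall phi, D n phi -> size_supp phi <= n%:R^-1.

Definition hat_le (phi psi : test_fun) : Prop := size_supp phi <= size_supp psi.

Fact hat_le_refl phi : hat_le phi phi.
Proof. exact: lexx. Qed.

Fact hat_le_trans phi psi chi :
  hat_le phi psi -> hat_le psi chi -> hat_le phi chi.
Proof. exact: le_trans. Qed.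

Fact ultrafilter_nonempty (U : set_system test_fun) :
  UltraFilter U -> forall A, U A -> A !=set0.
Proof. by move=> UU A; exact: filter_ex. Qed.

Definition hat_idx (U : set_system test_fun) (UU : UltraFilter U) : indices :=
  Indices hat_le_refl hat_le_trans (ultrafilter_nonempty UU).

Context {n : nat} (Omega : set 'rV[R]_n) (U : set_system test_fun).

Definition moderate_hat (u : test_fun -> smooth_fun Omega) : Prop :=
  forall K, compact K -> K `<=` Omega -> forall alpha : 'I_n -> nat,
  exists N : nat, exists2 H : R, 0 < H &
    \forall phi \near U,
      sup_mderiv K alpha (u phi) <= H * size_supp phi ^- N.

Definition negligible_hat (u : test_fun -> smooth_fun Omega) : Prop :=
  forall K, compact K -> K `<=` Omega -> forall (alpha : 'I_n -> nat) (m : nat),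
  exists2 H : R, 0 < H &
    \forall phi \near U,
      sup_mderiv K alpha (u phi) <= H * size_supp phi ^+ m.

End test_function_indices.

(* Main.v *)
Require Import Defs.
From HB Require Import structures.
From mathcomp Require Import all_boot all_order all_algebra.
From mathcomp Require Import all_classical all_reals all_analysis.
Import Order.TTheory GRing.Theory Num.Theory.
Import numFieldNormedType.Exports.
Local Open Scope classical_set_scope.
Local Open Scope ring_scope.

(** Both notions of big-O compare the same two nets; only the quantification
    over indices differs, so the theorem reduces to one equivalence for each of
    the two index sets, applied with [y] a power of the index.

    On ]0, 1], a bound valid for all small [e] can be started below any
    prescribed [a]. Conversely, a bound on the part of ]0, e1] below [e0] holds
    near [0^+] because [e0 > 0] ([bigO_specialP]).

    On test functions, the member [A] of the ultrafilter can be taken to be the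
    set where the bound holds; each [a] in [A] then serves as its own threshold.
    Conversely, one threshold [phi] gives the bound on the [psi] in [A] with
    [hat_le psi phi], and one needs these [psi] to form a member of [U]
    ([near_hat_le]). The members of [U] on which supports have diameter at most
    [1/k] provide this as soon as [size_supp phi > 0] ([size_supp_gt0]). That
    positivity is the only geometric point: a continuous nonzero function on a
    space of positive dimension is nonzero at two distinct points, and their
    distance bounds the diameter from below because a compact support makes the
    supremum defining it finite. *)

(** On a set without a supremum, [sup] takes the default value [0]. *)
Lemma sup_ge0 {R : realType} {A : set R} :
  (forall x, A x -> 0 <= x) -> 0 <= sup A.
Proof.
move=> A_ge0; have [[[x Ax] ubA]|supNA] := pselect (has_sup A); last first.
  by rewrite sup_out.
exact: le_trans (A_ge0 _ Ax) (ub_le_sup ubA Ax).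
Qed.

Section geometry.
Context {R : realType} {n : nat}.
Implicit Types (x y : 'rV[R]_n) (K : set 'rV[R]_n).

Lemma sup_mderiv_ge0 K alpha (f : 'rV[R]_n -> R) : 0 <= sup_mderiv K alpha f.
Proof. by apply: sup_ge0 => _ [x _ <-]; exact: normr_ge0. Qed.

Lemma edist_gt0 {x y} : x != y -> 0 < Defs.edist x y.
Proof.
move=> xNy; rewrite sqrtr_gt0 lt_def sumr_ge0 ?andbT; last first.
  by move=> i _; exact: sqr_ge0.
apply: contraNN xNy; rewrite psumr_eq0 => [/allP xy|i _]; last exact: sqr_ge0.
apply/eqP/rowP => i; apply/eqP; rewrite -subr_eq0 -sqrf_eq0.
exact: (implyP (xy i (mem_index_enum i))).
Qed.

Lemma coord_le_norm x i : `|x 0 i| <= `|x|.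
Proof.
rewrite [`|x|]mx_normrE.
exact: (le_bigmax _
  (fun ij : 'I_1 * 'I_n => `|x ij.1 ij.2|) (0, i)).
Qed.

(** The supremum in [diam] is meaningful on compact sets: the maximum norm
    bounds the coordinates of the points of [K], hence of their differences. *)
Lemma edist_bounded {K} : compact K ->
  has_ubound [set Defs.edist p.1 p.2 | p in K `*` K].
Proof.
move=> /compact_bounded [M [_ KM]].
exists (Num.sqrt (\sum_(i < n) ((M + 1) *+ 2) ^+ 2)) => _ [[x y] [/= Kx Ky] <-].
have KM1 z j : K z -> `|z 0 j| <= M + 1.
  move=> Kz; apply: le_trans (coord_le_norm z j) _.
  by apply: KM Kz; rewrite ltrDl.
rewrite ler_wsqrtr// ler_sum// => i _.
have xyM : `|x 0 i - y 0 i| <= (M + 1) *+ 2.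
  by rewrite mulr2n (le_trans (ler_normB _ _))// lerD// KM1.
rewrite -[leLHS]real_normK ?num_real// lerXn2r ?nnegrE//.
exact: le_trans xyM.
Qed.

Lemma diam_gt0 {K x y} : compact K -> K x -> K y -> x != y -> 0 < diam K.
Proof.
move=> cK Kx Ky xNy; apply: lt_le_trans (edist_gt0 xNy) _.
by apply: ub_le_sup; [exact: edist_bounded|exists (x, y)].
Qed.

End geometry.

Section test_functions.
Context {R : realType} {d : nat}.
Context (d_ge1 : (1 <= d)%N).
Implicit Type phi : test_fun R d.

(** If [phi] is nonzero at [x], it is still nonzero at a nearby [y], obtained by
    shifting every coordinate; [y] differs from [x] since there is a coordinate
    to shift. *)
Lemma size_supp_gt0 phi : 0 < size_supp phi.
Proof.
rewrite /size_supp; case: asboolP => // phiN0.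
have [x phix] : exists x, phi x != 0.
  apply: contra_notP phiN0 => /forallNP phi0; apply/funext => x.
  by apply/eqP/negPn/negP; exact: phi0.
have [cphi _] := tfun_smooth phi [::] (I : setT x).
have phi_near : nbhs x [set z | phi z != 0].
  exact: (cvgr_neq0 (phi x) cphi phix).
have /nbhs_ballP[e /= e_gt0 phie] := phi_near.
pose y := x + const_mx (e / 2).
have xy : ball x e y.
  split=> [|i j] //; rewrite !mxE /ball /= opprD addrA subrr sub0r normrN.
  rewrite gtr0_norm ?divr_gt0//.
  by rewrite ltr_pdivrMr// mulr_natr mulr2n ltrDl.
apply: (@diam_gt0 _ _ _ x y); first exact: tfun_supp.
- exact: subset_closure.
- exact/subset_closure/phie.
apply/eqP => /rowP /(_ (Ordinal d_ge1)) /eqP.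
rewrite !mxE -subr_eq0 opprD addrA subrr sub0r oppr_eq0 mulf_eq0 invr_eq0.
by rewrite pnatr_eq0 gt_eqF.
Qed.

(** Since [size_supp phi > 0], some [1/k] with [k >= 1] lies below it. *)
Lemma near_hat_le (U : set_system (test_fun R d)) {UF : Filter U} phi :
  shrinking U -> \forall psi \near U, hat_le psi phi.
Proof.
move=> [D DU]; have phi_gt0 := size_supp_gt0 phi.
pose k := (Num.truncn (size_supp phi)^-1).+1.
have [UD sizeD] := DU k isT.
apply: filterS UD => psi /sizeD /le_trans; apply.
by rewrite invf_ple ?posrE// ltW// truncnS_gt.
Qed.

(** Left to right, the set where the bound holds is itself the witness in [U],
    and every index is its own threshold by reflexivity. Right to left, a single
    threshold is enough by [near_hat_le]. *)
Lemma bigO_hatP {U : set_system (test_fun R d)} (UU : UltraFilter U)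
    {x y : test_fun R d -> R} :
  shrinking U -> (forall phi, 0 <= x phi) -> (forall phi, 0 <= y phi) ->
  (exists2 H : R, 0 < H & \forall phi \near U, x phi <= H * y phi) <->
  bigO_idx (I := hat_idx UU) x y.
Proof.
move=> shU x_ge0 y_ge0; split.
  move=> [H H_gt0 xHy]; exists [set phi | x phi <= H * y phi] => // phi phiA.
  exists H; split => //; exists phi; first by split => //; exact: hat_le_refl.
  by move=> psi [_ psiA]; rewrite !ger0_norm.
move=> [A UA xOy]; have [a Aa] := idx_fam_nonempty UA.
have [H [H_gt0 [phi _ xHy]]] := xOy a Aa.
exists H => //; near=> psi.
rewrite -(ger0_norm (x_ge0 psi)) -(ger0_norm (y_ge0 psi)).
by apply: xHy; split; near: psi => //; exact: near_hat_le.
Unshelve. all: by end_near. Qed.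

End test_functions.

Section special_bigO.
Context {R : realType}.
Local Notation to0 := (@to0 R).

(** The parameter [a] costs nothing in either direction: any threshold may be
    lowered, and a single [a] already gives a bound near [0^+]. *)
Lemma bigO_specialP {x y : unit_oc R -> R} :
  x =O_to0 y <-> bigO_idx (I := special_idx R) x y.
Proof.
split.
  move=> /eqO_exP[H H_gt0 /= xHy].
  have one01 : `]0, 1]%classic (1 : R) by rewrite /= in_itv /= ltr01 lexx.
  have [delta /= delta_gt0 xHd] := xHy.
  exists [set e | special_le e (exist _ 1 one01)].
    by exists (exist _ 1 one01).
  move=> a _; exists H; split => //.
  have /andP[a_gt0 a_le1] : 0 < sval a <= 1.
    by have /= := svalP a; rewrite in_itv.
  (* The threshold must lie below [a] and strictly inside the ball of radius
     [delta] on which the bound is known, hence [delta / 2]. *)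
  pose t := Num.min (sval a) (delta / 2).
  have t_gt0 : 0 < t by rewrite lt_min a_gt0 divr_gt0.
  have t01 : `]0, 1]%classic t by rewrite /= in_itv /= t_gt0 ge_min a_le1.
  exists (exist _ t t01).
    by split; rewrite /= /special_le /= ge_min ?lexx// a_le1.
  move=> [e e01] [/= et _].
  have e_gt0 : 0 < e by move: (e01); rewrite /= in_itv /= => /andP[].
  apply: xHd => //=; rewrite sub0r normrN gtr0_norm//.
  apply: le_lt_trans et _ => /=; rewrite gt_min; apply/orP; right.
  by rewrite ltr_pdivrMr// mulr_natr mulr2n ltrDl.
move=> [_ [e1 _ <-] xOy].
have [H [H_gt0 [e0 [_ e01] xHy]]] := xOy e1 (special_le_refl _).
apply/eqO_exP; exists H => //.
have e0_gt0 : 0 < sval e0 by have /= := svalP e0; rewrite in_itv /= => /andP[].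
apply: filterS (nbhs_right_le e0_gt0) => t te0 t01.
apply: xHy; split => //; exact: le_trans e01.
Qed.

End special_bigO.

Theorem corollary17 (R : realType) (n d : nat) (d_ge1 : (1 <= d)%N)
    (Omega : set 'rV[R]_n) (Omega_open : open Omega)
    (U : set_system (test_fun R d)) (UU : UltraFilter U)
    (U_free : free_filter U) (U_shrinking : shrinking U) :
  [/\ forall u : unit_oc R -> smooth_fun Omega,
        moderate_special u <->
        (forall K, compact K -> K `<=` Omega -> forall alpha : 'I_n -> nat,
         exists N : nat,
           bigO_idx (I := special_idx R)
             (fun e => sup_mderiv K alpha (u e)) (fun e => sval e ^- N)),
      forall u : unit_oc R -> smooth_fun Omega,
        negligible_special u <->
        (forall K, compact K -> K `<=` Omega -> forall (alpha : 'I_n -> nat)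
           (m : nat),
           bigO_idx (I := special_idx R)
             (fun e => sup_mderiv K alpha (u e)) (fun e => sval e ^+ m)),
      forall u : test_fun R d -> smooth_fun Omega,
        moderate_hat U u <->
        (forall K, compact K -> K `<=` Omega -> forall alpha : 'I_n -> nat,
         exists N : nat,
           bigO_idx (I := hat_idx UU)
             (fun phi => sup_mderiv K alpha (u phi))
             (fun phi => size_supp phi ^- N)) &
      forall u : test_fun R d -> smooth_fun Omega,
        negligible_hat U u <->
        (forall K, compact K -> K `<=` Omega -> forall (alpha : 'I_n -> nat)
           (m : nat),
           bigO_idx (I := hat_idx UU)
             (fun phi => sup_mderiv K alpha (u phi))
             (fun phi => size_supp phi ^+ m))].
Proof.
split=> u.
- by split=> uO K cK KO alpha; have [N uN] := uO K cK KO alpha;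
    exists N; apply/bigO_specialP.
- by split=> uO K cK KO alpha m; apply/bigO_specialP; exact: uO.
- have bigO_size K alpha N :
      (exists2 H : R, 0 < H & \forall phi \near U,
         sup_mderiv K alpha (u phi) <= H * size_supp phi ^- N) <->
      bigO_idx (I := hat_idx UU) (fun phi => sup_mderiv K alpha (u phi))
        (fun phi => size_supp phi ^- N).
    apply: (bigO_hatP d_ge1) => // phi; first exact: sup_mderiv_ge0.
    by rewrite invr_ge0 exprn_ge0// ltW// size_supp_gt0.
  by split=> uO K cK KO alpha; have [N /bigO_size uN] := uO K cK KO alpha;
    exists N.
- have bigO_size K alpha m :
      (exists2 H : R, 0 < H & \forall phi \near U,
         sup_mderiv K alpha (u phi) <= H * size_supp phi ^+ m) <->
      bigO_idx (I := hat_idx UU) (fun phi => sup_mderiv K alpha (u phi))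
        (fun phi => size_supp phi ^+ m).
    apply: (bigO_hatP d_ge1) => // phi; first exact: sup_mderiv_ge0.
    by rewrite exprn_ge0// ltW// size_supp_gt0.
  by split=> uO K cK KO alpha m; apply/bigO_size; exact: uO.
Qed.
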